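(* Let $\mathcal{A}$ be a unital operator algebra. The following assertions are equivalent: (i) the set of finite dimensional states is weak-$*$ dense in the state space $S_1(\mathcal{A})$; (ii) for every $a \in \mathcal{A}$, we have $\|a\| = \sup \{ \|\pi(a)\| \}$, where the supremum is taken over all completely contractive homomorphisms $\pi: \mathcal{A} \to B(\mathcal{H})$ with $\dim(\mathcal{H}) < \infty$.
   Context: An operator algebra is a norm closed (not necessarily self-adjoint) subalgebra $\mathcal{A} \subset B(\mathcal{K})$ for some complex Hilbert space $\mathcal{K}$; it is unital if $I_{\mathcal{K}} \in \mathcal{A}$. Homomorphisms in (ii) are not required to be unital. The state space $S_1(\mathcal{A})$ is the set of all unital contractive linear functionals $\varphi: \mathcal{A} \to \mathbb{C}$, equipped with the weak-$*$ topology of the dual space of $\mathcal{A}$. A state $\varphi \in S_1(\mathcal{A})$ is finite dimensional if there exist a finite dimensional Hilbert space $\mathcal{H}$, a unital completely contractive homomorphism $\pi: \mathcal{A} \to B(\mathcal{H})$ and a unit vector $\xi \in \mathcal{H}$ such that $\varphi(a) = \langle \pi(a)\xi, \xi \rangle$ for all $a \in \mathcal{A}$. *)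

(* Defs.v *)
From HB Require Import structures.
From mathcomp Require Import all_boot all_order all_algebra.
From mathcomp Require Import complex.
From mathcomp Require Import all_classical all_reals all_analysis.

Set Implicit Arguments.
Unset Strict Implicit.
Unset Printing Implicit Defensive.

Import Order.TTheory GRing.Theory Num.Theory.
Import numFieldNormedType.Exports.

Local Open Scope classical_set_scope.
Local Open Scope ring_scope.
Local Open Scope complex_scope.

HB.instance Definition _ (R : realType) := NormedModule.copy R[i] R[i]^o.

(* The inner product is linear in its first argument and conjugate-linear in
   the second one; the norm and the topology are those of the underlying
   Banach space, which the inner product is required to induce. *)
HB.mixin Record hasInner (R : realType) (K : Type)
    & CompleteNormedModule R[i] K := {
  inner : {dot K for (@Num.Def.conjC R[i])};
  inner_norm : forall x : K, inner x x = `|x| ^+ 2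
}.

#[short(type="hilbertType")]
HB.structure Definition Hilbert (R : realType) :=
  { K of CompleteNormedModule R[i] K & hasInner R K }.

#[short(type="finHilbertType")]
HB.structure Definition FinHilbert (R : realType) :=
  { K of Hilbert R K & Vector R[i] K }.

(* Norms in a normed module over [R[i]] are elements of [R[i]] with zero
   imaginary part; [rnorm] is the same number seen in [R]. *)
Definition rnorm (R : realType) (V : normedModType R[i]) (x : V) : R :=
  complex.Re `|x|.

Section RNorm.
Variables (R : realType) (V : normedModType R[i]).
Implicit Types x y : V.

Lemma rnormE x : (rnorm x)%:C = `|x|.
Proof. by rewrite RRe_real// normr_real. Qed.

Lemma rnorm_ge0 x : 0 <= rnorm x.
Proof. by rewrite -ler0c rnormE normr_ge0. Qed.

Lemma rnorm0 : rnorm (0 : V) = 0.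
Proof. by rewrite /rnorm normr0. Qed.

Lemma rnorm_eq0 x : rnorm x = 0 -> x = 0.
Proof. by move=> x0; apply: normr0_eq0; rewrite -rnormE x0. Qed.

Lemma rnormD x y : rnorm (x + y) <= rnorm x + rnorm y.
Proof. by rewrite -lecR rmorphD /= !rnormE ler_normD. Qed.

Lemma rnormZ (c : R[i]) x : rnorm (c *: x) = rnorm c * rnorm x.
Proof. by apply: complexI; rewrite rmorphM /= !rnormE normrZ. Qed.

End RNorm.

Section BoundedOperators.
Variables (R : realType) (K : hilbertType R).

Definition is_bounded_operator (f : K -> K) : Prop :=
  linear f /\ exists M : R, forall x, rnorm (f x) <= M * rnorm x.

Definition bounded_operator : {pred K -> K} :=
  fun f => `[< is_bounded_operator f >].

Record bop := Bop { bop_fun :> K -> K; bopP : bop_fun \in bounded_operator }.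

HB.instance Definition _ := [isSub for bop_fun].
HB.instance Definition _ := [Choice of bop by <:].

Lemma bop_linear (f : bop) : linear f.
Proof. by case: f => f /= /asboolP[]. Qed.

Lemma bop_bounded (f : bop) : exists M : R, forall x, rnorm (f x) <= M * rnorm x.
Proof. by case: f => f /= /asboolP[]. Qed.

HB.instance Definition _ (f : bop) := GRing.isLinear.Build R[i] K K _ f (bop_linear f).

Lemma bop_ext (f g : bop) : f =1 g -> f = g.
Proof. by move=> fg; apply/val_inj/funext. Qed.

Lemma bounded_operator_submod : submod_closed bounded_operator.
Proof.
split=> [|c f g /asboolP[fl [M fM]] /asboolP[gl [N gN]]]; apply/asboolP; split.
- by move=> a x y; rewrite scaler0 addr0.
- by exists 0 => x; rewrite rnorm0 mul0r.
- move=> a x y; rewrite !fctE/= fl gl !scalerDr !scalerA.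
  by rewrite (mulrC c a) addrACA.
exists (rnorm c * M + N) => x; rewrite !fctE/=.
rewrite (le_trans (rnormD _ _))// mulrDl lerD// rnormZ -mulrA.
by rewrite ler_wpM2l// rnorm_ge0.
Qed.

HB.instance Definition _ :=
  GRing.SubChoice_isSubLmodule.Build _ _ _ bop bounded_operator_submod.

Lemma id_bounded_operator : (idfun : K -> K) \in bounded_operator.
Proof. by apply/asboolP; split=> //; exists 1 => x; rewrite mul1r. Qed.

Lemma comp_bounded_operator (f g : bop) : (f \o g : K -> K) \in bounded_operator.
Proof.
apply/asboolP; split=> [c x y|]; first by rewrite /= !linearP.
have [M fM] := bop_bounded f; have [N gN] := bop_bounded g.
exists (Num.max M 0 * N) => x /=.
rewrite (le_trans (fM _))// -mulrA.
rewrite (@le_trans _ _ (Num.max M 0 * rnorm (g x)))//.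
  by rewrite ler_wpM2r ?rnorm_ge0// le_max lexx.
by rewrite ler_wpM2l// le_max lexx orbT.
Qed.

Definition bop_one : bop := Bop id_bounded_operator.
Definition bop_comp (f g : bop) : bop := Bop (comp_bounded_operator f g).

Fact bop_compA : associative bop_comp. Proof. by move=> f g h; exact: bop_ext. Qed.
Fact bop_comp1l : left_id bop_one bop_comp. Proof. by move=> f; exact: bop_ext. Qed.
Fact bop_comp1r : right_id bop_one bop_comp. Proof. by move=> f; exact: bop_ext. Qed.
Fact bop_compDl : left_distributive bop_comp +%R.
Proof. by move=> f g h; exact: bop_ext. Qed.
Fact bop_compDr : right_distributive bop_comp +%R.
Proof. by move=> f g h; apply: bop_ext => x /=; rewrite !fctE/= linearD. Qed.

HB.instance Definition _ := GRing.Zmodule_isPzRing.Build bop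
  bop_compA bop_comp1l bop_comp1r bop_compDl bop_compDr.

Definition opnorm (f : bop) : R :=
  sup [set rnorm (f x) | x in [set x | rnorm x <= 1]].

Lemma opnorm_has_sup (f : bop) :
  has_sup [set rnorm (f x) | x in [set x | rnorm x <= 1]].
Proof.
split; first by exists (rnorm (f 0)); exists 0 => //=; rewrite rnorm0 ler01.
have [M fM] := bop_bounded f; exists (Num.max M 0) => _ [x /= x1 <-].
rewrite (le_trans (fM x))// (@le_trans _ _ (Num.max M 0 * rnorm x))//.
  by rewrite ler_wpM2r ?rnorm_ge0// le_max lexx.
by rewrite ler_piMr// le_max lexx orbT.
Qed.

Lemma opnorm_ub (f : bop) (x : K) : rnorm x <= 1 -> rnorm (f x) <= opnorm f.
Proof. by move=> x1; apply: sup_upper_bound (opnorm_has_sup f) _ _; exists x. Qed.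

Lemma opnorm_le (f : bop) (M : R) :
  (forall x : K, rnorm x <= 1 -> rnorm (f x) <= M) -> opnorm f <= M.
Proof.
move=> fM; apply: ge_sup; first by case: (opnorm_has_sup f).
by move=> _ [x /= x1 <-]; exact: fM.
Qed.

Lemma opnorm_ge0 (f : bop) : 0 <= opnorm f.
Proof. by rewrite (le_trans (rnorm_ge0 (f 0)))// opnorm_ub// rnorm0 ler01. Qed.

Lemma opnormD (f g : bop) : opnorm (f + g) <= opnorm f + opnorm g.
Proof.
apply: opnorm_le => x x1.
by rewrite (le_trans (rnormD _ _))// lerD// opnorm_ub.
Qed.

Lemma opnormZ (c : R[i]) (f : bop) : opnorm (c *: f) = rnorm c * opnorm f.
Proof.
have le_opnormZ d g : opnorm (d *: g) <= rnorm d * opnorm g.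
  apply: opnorm_le => x x1; rewrite [leLHS]rnormZ ler_wpM2l ?rnorm_ge0//.
  exact: opnorm_ub.
have [->|c0] := eqVneq c 0.
  apply/eqP; rewrite eq_le le_opnormZ andTb rnorm0 mul0r.
  exact: opnorm_ge0.
apply/eqP; rewrite eq_le le_opnormZ andTb.
have c_gt0 : 0 < rnorm c by rewrite -ltcR rnormE normr_gt0.
rewrite -ler_pdivlMl//; rewrite -[in leLHS](scalerK c0 f).
rewrite (le_trans (le_opnormZ _ _))// ler_wpM2r ?opnorm_ge0//.
suff -> : rnorm c^-1 = (rnorm c)^-1 by [].
by apply: complexI; rewrite fmorphV /= !rnormE normfV.
Qed.

Lemma opnorm_eq0 (f : bop) : opnorm f = 0 -> f = 0.
Proof.
move=> f0; apply: bop_ext => x.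
have [->|x0] := eqVneq x 0; first by rewrite linear0.
have nx0 : `|x| != 0 by rewrite normr_eq0.
have y1 : rnorm (`|x|^-1 *: x) = 1.
  by apply: complexI; rewrite rnormE normrZ normfV normr_id mulVf.
have /rnorm_eq0 : rnorm (f (`|x|^-1 *: x)) = 0.
  by apply/eqP; rewrite eq_le rnorm_ge0 andbT -f0 opnorm_ub// y1.
by rewrite linearZ => /eqP; rewrite scaler_eq0 invr_eq0 (negPf nx0) => /eqP.
Qed.

Let cnorm (f : bop) : R[i] := (opnorm f)%:C.

Let cnormD (f g : bop) : cnorm (f + g) <= cnorm f + cnorm g.
Proof. by rewrite /cnorm -rmorphD /= lecR opnormD. Qed.

Let cnormZ (c : R[i]) (f : bop) : cnorm (c *: f) = `|c| * cnorm f.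
Proof. by rewrite /cnorm opnormZ rmorphM /= rnormE. Qed.

Let cnorm0_eq0 (f : bop) : cnorm f = 0 -> f = 0.
Proof. by move=> /complexI; exact: opnorm_eq0. Qed.

HB.instance Definition _ :=
  Lmodule_isNormed.Build R[i] bop cnormD cnormZ cnorm0_eq0.

Lemma bop_normE (f : bop) : `|f| = (opnorm f)%:C. Proof. by []. Qed.

End BoundedOperators.

Section OperatorAlgebras.
Variables (R : realType) (K : hilbertType R).

(* The type of elements of [A] is obtained from [A] by coercion. [bop K] is not
   a [lalgType] because it is the trivial ring when [K] is the zero space. *)
Record unitalOperatorAlgebra := UnitalOperatorAlgebra {
  opalg_set :> {pred bop K};
  opalg_submod : submod_closed opalg_set;
  opalg_subring : subring_closed opalg_set;
  opalg_closed : closed [set a : bop K | a \in opalg_set]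
}.

Variable A : unitalOperatorAlgebra.

Record opalg_sort :=
  OpalgElt { opalg_val :> bop K; opalg_valP : opalg_val \in opalg_set A }.

HB.instance Definition _ := [isSub for opalg_val].
HB.instance Definition _ := [Choice of opalg_sort by <:].
HB.instance Definition _ :=
  GRing.SubChoice_isSubLmodule.Build _ _ _ opalg_sort (opalg_submod A).
HB.instance Definition _ :=
  GRing.SubZmodule_isSubPzRing.Build _ _ opalg_sort (opalg_subring A).
End OperatorAlgebras.

Coercion opalg_sort : unitalOperatorAlgebra >-> Sortclass.

(* The norm of [T] as an operator on the Hilbert space direct sum [K^n] *)
Definition l2norm (R : realType) (K : hilbertType R) n (x : 'I_n -> K) : R :=
  Num.sqrt (\sum_(i < n) rnorm (x i) ^+ 2).

Definition mx_opnorm (R : realType) (K : hilbertType R) n (T : 'M[bop K]_n) : R :=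
  sup [set l2norm (fun i => \sum_(j < n) T i j (x j)) |
       x in [set x : 'I_n -> K | l2norm x <= 1]].

Section States.
Variables (R : realType) (K : hilbertType R) (A : unitalOperatorAlgebra K).

Definition completely_contractive (H : hilbertType R) (pi : A -> bop H) : Prop :=
  forall n (T : 'M[A]_n),
    mx_opnorm (map_mx pi T) <= mx_opnorm (map_mx (@opalg_val R K A) T).

(* Not required to be unital *)
Definition algebra_hom (H : hilbertType R) (pi : A -> bop H) : Prop :=
  linear pi /\ {morph pi : a b / a * b}.

(* The weak-* topology of the dual space is the topology of pointwise
   convergence, hence the ambient space [{ptws A -> R[i]}]. *)
Definition state_space : set {ptws A -> R[i]} :=
  [set phi : A -> R[i] |
    [/\ scalar phi, phi 1 = 1 & forall a : A, `|phi a| <= `|opalg_val a|]].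

Definition finite_dimensional_state : set {ptws A -> R[i]} :=
  [set phi : A -> R[i] | state_space phi /\
    exists (H : finHilbertType R) (pi : A -> bop H) (xi : H),
      [/\ algebra_hom pi, completely_contractive pi, pi 1 = 1, `|xi| = 1 &
          forall a : A, phi a = inner (pi a xi) xi]].

End States.

(* Main.v *)
From HB Require Import structures.
Require Import Defs.
From mathcomp Require Import all_boot all_order all_algebra.
From mathcomp Require Import complex.
From mathcomp Require Import all_classical all_reals all_analysis.
From mathcomp Require Import ring lra.

(** Both implications compare the norm of [A] with numerical ranges, the only
    trace of the norm that the states see.

    From norms to states.  The finite dimensional states form a convex set,
    because two representations can be put side by side on a Hilbert sum
    ([fd_state_convex]).  Weak-* closeness only concerns finitely many elements
    of [A], that is, points of [C^n], where a point that is not separated from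
    a bounded convex set by a linear functional lies in its closure
    ([convex_approx]).  So it is enough that for each state [phi] and each [a]
    some finite dimensional state [psi] has [Re (psi a)] almost as large as
    [Re (phi a)] ([num_range_approx]).  This is the first order part, for small
    [t > 0], of [1 + t Re (phi a) <= `|1 + t a|]: by assumption the right hand
    side is nearly attained as [`|pi (1 + t a) xi|], whose square expands into
    [1 + 2 t Re <pi(a) xi, xi> + O(t^2)].  A representation here need not be
    unital, but [pi 1] is idempotent and [xi] may be chosen in its range, which
    is invariant under [pi]; compressing to that range gives a unital
    representation ([fd_state_of_fixed_vector]).

    From states to norms.  Numerical ranges alone determine the norm only up to
    a factor 2; multiplicativity is what makes the estimate sharp.  An operator
    [T] with [1 - T] invertible is a contraction as soon as its Cayley transform
    [(1 + T) / (1 - T)] has nonnegative real part, and this positivity is a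
    property of the numerical range.  Assume [`|pi a| <= r < 1] for all finite
    dimensional [pi].  The Cayley transforms of the [pi a] have nonnegative real
    part, hence the partial sums [1 + 2 (a + ... + a^n)] of the Cayley transform
    of [a] have real part at least [- O(r^n)] in all finite dimensional states,
    by density in all states ([state_cayley]), and in particular in the vector
    states of [K].  For [y := z - a z] this reads
    [`|z|^2 - `|a z|^2 - 2 Re <a^(n+1) z, y> >= - O(r^n)], and the extra term
    vanishes in the limit since the numerical radius of [a^(n+1)] is at most
    [r^(n+1)], again by density ([state_pow]).  Hence [`|a| <= 1]
    ([opnorm_le1]), and a rescaling concludes ([rep_norm_dense]).

    The finite dimensional Hilbert spaces needed on the way (ranges of
    idempotents, Hilbert sums, [C^n]) are all instances of one fact: a finite
    dimensional inner product space is complete ([ip_space_complete]). *)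

Set Implicit Arguments.
Unset Strict Implicit.
Unset Printing Implicit Defensive.

Import Order.TTheory GRing.Theory Num.Theory.
Import numFieldNormedType.Exports.

Local Open Scope classical_set_scope.
Local Open Scope ring_scope.
Local Open Scope complex_scope.

(** * Real-valued norms *)

Section ComplexNorm.
Variable R : realType.
Implicit Types z w : R[i].

Lemma rnormM z w : rnorm (z * w) = rnorm z * rnorm w.
Proof. by apply: complexI; rewrite rmorphM /= !rnormE normrM. Qed.

Lemma Re_scale (t : R) z : complex.Re (t%:C * z) = t * complex.Re z.
Proof. by case: z => x y /=; rewrite mul0r subr0. Qed.

Lemma rnorm_conj z : rnorm z^*%C = rnorm z.
Proof. by rewrite /rnorm normcJ. Qed.

Lemma rnorm_real (x : R) : rnorm x%:C = `|x|.
Proof. by rewrite /rnorm normc_def /= expr0n addr0 sqrtr_sqr. Qed.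

Lemma rnorm_i : rnorm ('i%C : R[i]) = 1.
Proof. by rewrite /rnorm complexiE normCi. Qed.

Lemma Re_rnorm z : `|complex.Re z| <= rnorm z.
Proof. by have := normc_ge_Re z; rewrite lecE => /andP[]. Qed.

Lemma Im_rnorm z : `|complex.Im z| <= rnorm z.
Proof.
by have := Re_rnorm (z * 'i%C); rewrite ReiNIm normrN rnormM rnorm_i mulr1.
Qed.

Lemma rnorm_ReIm z : rnorm z <= `|complex.Re z| + `|complex.Im z|.
Proof.
rewrite [X in rnorm X]complexE (le_trans (rnormD _ _))//.
by rewrite rnormM rnorm_i mul1r !rnorm_real.
Qed.

End ComplexNorm.

Section NormedModule.
Variables (R : realType) (V : normedModType R[i]).
Implicit Types x y : V.

Lemma rnormN x : rnorm (- x) = rnorm x.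
Proof. by rewrite /rnorm normrN. Qed.

Lemma rnormB x y : rnorm (x - y) <= rnorm x + rnorm y.
Proof. by rewrite -(rnormN y) rnormD. Qed.

Lemma rnorm_distC x y : rnorm (x - y) = rnorm (y - x).
Proof. by rewrite -rnormN opprB. Qed.

Lemma rnorm_gt0 x : (0 < rnorm x) = (x != 0).
Proof. by rewrite -ltcR rnormE normr_gt0. Qed.

Lemma rnormMn x n : rnorm (x *+ n) = rnorm x *+ n.
Proof. by rewrite /rnorm normrMn raddfMn. Qed.

Lemma rnorm_normalize x : x != 0 -> rnorm ((rnorm x)^-1%:C *: x) = 1.
Proof.
rewrite -rnorm_gt0 => x0.
by rewrite rnormZ rnorm_real gtr0_norm ?invr_gt0// mulVf ?gt_eqF.
Qed.

Lemma rnorm_sum (I : finType) (F : I -> V) :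
  rnorm (\sum_i F i) <= \sum_i rnorm (F i).
Proof.
elim/big_ind2 : _ => [|x a y b xa yb|//]; first by rewrite rnorm0.
by rewrite (le_trans (rnormD _ _)) ?lerD.
Qed.

End NormedModule.

Lemma sum_sqr_le (R : realType) (I : finType) (F : I -> R) :
  (forall i, 0 <= F i) -> \sum_i F i ^+ 2 <= (\sum_i F i) ^+ 2.
Proof.
move=> F0; rewrite expr2 mulr_suml; apply: ler_sum => i _.
by rewrite expr2 ler_wpM2l// (bigD1 i)//= lerDl sumr_ge0.
Qed.

(** * Finite dimensional inner product spaces *)

Section InnerProductSpace.
Variables (R : realType) (V : vectType R[i]).

(** The form [f] is a parameter of the alias so that the structures below, which
    depend on it, are found by inference. *)
Definition ip_space (f : {dot V for (@Num.Def.conjC R[i])}) : Type := V.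

Variable f : {dot V for (@Num.Def.conjC R[i])}.

HB.instance Definition _ := Vector.on (ip_space f).

Let N (x : ip_space f) : R[i] := sqrtC (f x x).

Let ND (x y : ip_space f) : N (x + y) <= N x + N y.
Proof. by have [] := triangle_lerif f x y. Qed.

Let NZ (c : R[i]) (x : ip_space f) : N (c *: x) = `|c| * N x.
Proof.
by rewrite /N dnormZ sqrtCM ?qualifE/= ?exprn_ge0 ?dnorm_ge0// exprCK.
Qed.

Let N0 (x : ip_space f) : N x = 0 -> x = 0.
Proof. by move/eqP; rewrite sqrt_dnorm_eq0 => /eqP. Qed.

HB.instance Definition _ :=
  Lmodule_isNormed.Build R[i] (ip_space f) ND NZ N0.

Lemma ip_space_normE (x : ip_space f) : `|x| = sqrtC (f x x).
Proof. by []. Qed.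

End InnerProductSpace.

Section Dual.
Variables (R : realType) (V : vectType R[i]).
Variable f : {dot V for (@Num.Def.conjC R[i])}.

(** A dual pair of families: the vectors [e i] form a basis and the [w i] are the
    images of the standard vectors under the inverse of the injective map
    [v |-> (f v (e i))_i].  It writes each coordinate of [v] as an inner product,
    hence as a bounded functional, without orthonormalizing a basis. *)
Lemma dot_dual_family : exists n (e w : 'I_n -> V),
  forall v, v = \sum_i f v (e i) *: w i.
Proof.
pose n := \dim {:V}; pose e (i : 'I_n) := (vbasis {:V})`_i.
pose L (v : V) : 'rV[R[i]]_n := \row_i f v (e i).
have L_lin : linear L.
  by move=> c x y; apply/rowP => i; rewrite !mxE linearPl.
pose Lm := GRing.isLinear.Build R[i] V 'rV[R[i]]_n _ L L_lin.
pose LL : {linear V -> 'rV[R[i]]_n} := HB.pack L Lm.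
have [l lE] : exists l : 'Hom(V, 'rV[R[i]]_n), l =1 L.
  by exists (linfun LL) => v; rewrite (lfunE LL).
have l0 : lker l == 0%VS.
  (* a vector orthogonal to a basis is orthogonal to itself *)
  apply/lker0P => x y; rewrite !lE => Lxy; apply/eqP; rewrite -subr_eq0.
  rewrite -(dnorm_eq0 f); apply/eqP.
  have fe i : f (x - y) (e i) = 0.
    by move/rowP/(_ i): Lxy; rewrite !mxE linearBl/= => ->; rewrite subrr.
  rewrite {2}(coord_vbasis (memvf (x - y))) linear_sumr big1// => i _.
  by rewrite linearZr_LR /= fe mulr0.
exists n, e, (fun i => (l^-1)%VF (delta_mx 0 i)) => v.
rewrite -[LHS](lker0_lfunK l0) [X in (_^-1)%VF X]row_sum_delta linear_sum/=.
by apply: eq_bigr => i _; rewrite linearZ/= lE mxE.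
Qed.

End Dual.

Section Complete.
Variables (R : realType) (V : vectType R[i]).
Variable f : {dot V for (@Num.Def.conjC R[i])}.
Local Notation H := (ip_space f).

Lemma ip_space_CauchySchwarz (x y : H) : rnorm (f x y) <= rnorm x * rnorm y.
Proof.
rewrite -lecR rmorphM /= !rnormE.
by have [] := CauchySchwarz_sqrt f x y.
Qed.

Lemma cauchy_functional_cvg (F : set_system H) (g : H -> R) (M : R) :
  ProperFilter F -> cauchy F -> (forall x y, g (x - y) = g x - g y) ->
  (forall x, `|g x| <= M * rnorm x) ->
  exists c : R, forall e, 0 < e -> \forall v \near F, `|g v - c| < e.
Proof.
move=> FF Fc gB gM.
have gFc : cauchy (g @ F).
  apply/cauchyP => e e0.
  pose M' := Num.max M 1; have M0 : 0 < M' by rewrite lt_max ltr01 orbT.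
  have /cauchyP/(_ (e / M')%:C%C) := Fc.
  rewrite ltcR divr_gt0// => /(_ isT)[x Fx]; exists (g x).
  suff : F (g @^-1` ball (g x) e) by [].
  apply: filterS Fx => y; rewrite /preimage -!ball_normE /= -rnormE ltcR => xy.
  rewrite -gB (le_lt_trans (gM _))//.
  rewrite (@le_lt_trans _ _ (M' * rnorm (x - y)))//.
    by rewrite ler_wpM2r ?rnorm_ge0// le_max lexx.
  by rewrite mulrC -ltr_pdivlMr.
have /cvg_ex[c gc] := @R_complete _ _ (fmap_proper_filter g FF) gFc.
exists c => e e0.
by move/cvgr_distC_lt: gc => /(_ _ e0).
Qed.

(** Cauchy filters converge because their coordinates do: these are bounded
    functionals by Cauchy-Schwarz, and [R] is complete. *)
Lemma ip_space_complete (F : set_system H) :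
  ProperFilter F -> cauchy F -> cvg F.
Proof.
move=> FF Fc; have [n [b [w bw]]] := dot_dual_family f.
have cvg_coord i : exists c : R[i], forall e : R, 0 < e ->
    \forall v \near F, rnorm (f v (b i) - c) < e.
  pose M := rnorm (b i : H).
  have le_M (x : H) : rnorm (f x (b i)) <= M * rnorm x.
    by rewrite mulrC; exact: ip_space_CauchySchwarz.
  have [|x|c1 c1P] :=
    @cauchy_functional_cvg F (fun v => complex.Re (f v (b i))) M FF Fc.
  - by move=> x y; rewrite linearBl raddfB.
  - exact: le_trans (Re_rnorm _) (le_M x).
  have [|x|c2 c2P] :=
    @cauchy_functional_cvg F (fun v => complex.Im (f v (b i))) M FF Fc.
  - by move=> x y; rewrite linearBl raddfB.
  - exact: le_trans (Im_rnorm _) (le_M x).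
  exists (c1%:C + 'i * c2%:C)%C => e e0.
  have e2 : 0 < e / 2 by rewrite divr_gt0.
  near=> v.
  apply: le_lt_trans (rnorm_ReIm _) _; rewrite !raddfB/=.
  rewrite mul0r !mul1r mul0r subr0 addr0 add0r add0r [e in _ < e]splitr.
  by apply: ltrD; near: v; [exact: c1P | exact: c2P].
have [c cP] := choice cvg_coord.
apply/cvg_ex; exists (\sum_i c i *: w i : H).
apply/cvgrPdistC_lt => e e0.
have er : e = (complex.Re e)%:C%C by rewrite RRe_real// gtr0_real.
move: e0; rewrite er ltcR; move: (complex.Re e) => {er}e e0.
pose W := 1 + \sum_i rnorm (w i : H).
have W0 : 0 < W by rewrite ltr_pwDl// sumr_ge0// => i _; exact: rnorm_ge0.
have eW0 : 0 < e / W by rewrite divr_gt0.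
have : \forall v \near F, forall i, rnorm (f v (b i) - c i) < e / W.
  by apply: filter_forall => i; exact: cP.
apply: filterS => v vP; rewrite -rnormE ltcR.
rewrite [X in X - _](bw v) -sumrB.
apply: le_lt_trans (rnorm_sum _) _.
apply: (@le_lt_trans _ _ (\sum_i e / W * rnorm (w i : H))).
  by apply: ler_sum => i _; rewrite -scalerBl rnormZ ler_wpM2r ?rnorm_ge0// ltW.
by rewrite -mulr_sumr mulrAC ltr_pdivrMr// ltr_pM2l// ltr_pwDl.
Unshelve. all: by end_near. Qed.

HB.instance Definition _ := Uniform_isComplete.Build H ip_space_complete.

Lemma ip_space_inner_norm (x : H) : f x x = `|x| ^+ 2.
Proof. by rewrite ip_space_normE sqrtCK. Qed.

HB.instance Definition _ := hasInner.Build R H ip_space_inner_norm.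

End Complete.

(** * Hilbert spaces and their operators *)

Section HilbertSpace.
Variables (R : realType) (K : hilbertType R).
Implicit Types x y : K.

Lemma Re_inner_norm x : complex.Re (inner x x) = rnorm x ^+ 2.
Proof. by rewrite inner_norm -rnormE -rmorphXn. Qed.

Lemma inner_conj x y : inner y x = (inner x y)^*%C.
Proof. by rewrite hermC /= expr0 mul1r. Qed.

Lemma Re_inner_sym x y : complex.Re (inner y x) = complex.Re (inner x y).
Proof. by rewrite inner_conj; case: (inner x y). Qed.

Lemma innerZr (c : R[i]) x y : inner x (c *: y) = c^*%C * inner x y.
Proof. by rewrite linearZr_LR. Qed.

Lemma innerZZ (c : R[i]) x y :
  inner (c *: x) (c *: y) = c * c^* * inner x y.
Proof. by rewrite linearZl_LR linearZr_LR/= mulrA. Qed.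

Lemma rnormD_sqr x y :
  rnorm (x + y) ^+ 2 = rnorm x ^+ 2 + rnorm y ^+ 2 + complex.Re (inner x y) *+ 2.
Proof.
rewrite -!Re_inner_norm linearDl/= !linearDr/= !raddfD/= (Re_inner_sym x y).
by rewrite mulr2n -!addrA; congr (_ + _); rewrite [RHS]addrCA !addrA [LHS]addrAC.
Qed.

(** The norm of a Hilbert space satisfies the triangle inequality by definition,
    so Cauchy-Schwarz can be read off its square. *)
Lemma Re_inner_le x y : complex.Re (inner x y) <= rnorm x * rnorm y.
Proof.
have : rnorm (x + y) ^+ 2 <= (rnorm x + rnorm y) ^+ 2.
  by rewrite ler_sqr ?nnegrE ?addr_ge0 ?rnorm_ge0// rnormD.
rewrite rnormD_sqr sqrrD addrAC lerD2r lerD2l.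
by rewrite lerMn2r.
Qed.

Lemma inner_le x y : rnorm (inner x y) <= rnorm x * rnorm y.
Proof.
have [->|c0] := eqVneq (inner x y) 0; first by rewrite rnorm0 mulr_ge0 ?rnorm_ge0.
(* rotate x so that the inner product becomes a positive real *)
pose r := rnorm (inner x y); have r0 : 0 < r by rewrite rnorm_gt0.
pose u := (inner x y)^* * (r^-1)%:C.
have u1 : rnorm u = 1.
  by rewrite rnormM rnorm_conj rnorm_real gtr0_norm ?invr_gt0// mulfV ?gt_eqF.
rewrite -/r; have <- : complex.Re (inner (u *: x) y) = r.
  rewrite linearZl_LR/= /u mulrAC [_^* * _]mulrC -sqr_normc -rnormE -rmorphXn.
  by rewrite -rmorphM /= -/r expr2 mulfK ?gt_eqF.
by rewrite (le_trans (Re_inner_le _ _))// rnormZ u1 mul1r.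
Qed.

End HilbertSpace.

Section OperatorNorm.
Variables (R : realType) (K : hilbertType R).

Lemma opnorm_bound (f : bop K) x : rnorm (f x) <= opnorm f * rnorm x.
Proof.
have [->|x0] := eqVneq x 0; first by rewrite linear0 rnorm0 mulr0.
have nx0 : 0 < rnorm x by rewrite rnorm_gt0.
rewrite -ler_pdivrMr// mulrC.
have <- : rnorm (f ((rnorm x)^-1%:C *: x)) = (rnorm x)^-1 * rnorm (f x).
  by rewrite linearZ/= rnormZ rnorm_real ger0_norm ?invr_ge0 ?rnorm_ge0.
apply: opnorm_ub; rewrite rnormZ rnorm_real ger0_norm ?invr_ge0 ?rnorm_ge0//.
by rewrite mulVf ?gt_eqF.
Qed.

Lemma ex_bop (f : K -> K) (M : R) : linear f ->
  (forall x, rnorm (f x) <= M * rnorm x) -> exists g : bop K, g =1 f.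
Proof.
move=> fl fM; have fP : f \in @bounded_operator R K.
  by apply/asboolP; split=> //; exists M.
by exists (Bop fP).
Qed.

End OperatorNorm.

Section Polarization.
Variables (R : realType) (H : hilbertType R) (T : bop H).

Let D x u := inner (T x) u + inner (T u) x.

Let inner_polarization (x y : H) :
  inner (T x) y *+ 2 = D x y + 'i%C * D x ('i%C *: y).
Proof.
have ci : ('i%C : R[i])^*%C = - 'i%C.
  by apply/eqP; rewrite eq_complex /= oppr0 !eqxx.
have ii : ('i%C : R[i]) * 'i%C = -1 by rewrite -expr2 sqr_i.
rewrite /D [T ('i%C *: y)]linearZ linearZl_LR innerZr ci mulrDr !mulrA mulrN.
by rewrite ii opprK mul1r mulN1r mulr2n addrACA subrr addr0.
Qed.

(** An operator is controlled by its numerical radius; the constant 3 is not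
    optimal, any constant would do below. *)
Lemma numerical_radius_bound (w : R) : 0 <= w ->
  (forall x, rnorm (inner (T x) x) <= w * rnorm x ^+ 2) ->
  forall x y, rnorm (inner (T x) y) <= 3 * w * (rnorm x ^+ 2 + rnorm y ^+ 2).
Proof.
move=> w0 Tw x y.
have D_le u : rnorm (D x u) <= 3 * w * (rnorm x ^+ 2 + rnorm u ^+ 2).
  have -> : D x u =
      inner (T (x + u)) (x + u) - inner (T x) x - inner (T u) u.
    by rewrite [T _]linearD linearDl/= !linearDr/= /D; ring.
  apply: le_trans (rnormB _ _) _; apply: le_trans (lerD (rnormB _ _) (Tw u)) _.
  apply: le_trans (lerD (lerD (Tw (x + u)) (Tw x)) (lexx _)) _.
  rewrite -!mulrDr [3 * w]mulrC -mulrA ler_wpM2l//.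
  have s_le : rnorm (x + u) ^+ 2 <= (rnorm x + rnorm u) ^+ 2.
    by rewrite ler_sqr ?nnegrE ?addr_ge0 ?rnorm_ge0// rnormD.
  have := sqr_ge0 (rnorm x - rnorm u); move: s_le.
  by rewrite sqrrB sqrrD; lra.
have iy : rnorm ('i%C *: y) = rnorm y by rewrite rnormZ rnorm_i mul1r.
have h2 : rnorm (inner (T x) y *+ 2) = 2 * rnorm (inner (T x) y).
  by rewrite rnormMn mulr_natl.
rewrite -(ler_pM2l (ltr0n R 2)) -h2 inner_polarization.
apply: le_trans (rnormD _ _) _; rewrite rnormM rnorm_i mul1r.
apply: le_trans (lerD (D_le _) (D_le _)) _; rewrite iy.
by rewrite [leRHS]mulr_natl.
Qed.

End Polarization.

Section MatrixNorm.
Variables (R : realType) (K : hilbertType R) (n : nat).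
Implicit Types (x : 'I_n -> K) (T : 'M[bop K]_n).

Definition mx_app T x : 'I_n -> K := fun i => \sum_(j < n) T i j (x j).

Lemma l2norm_ge0 x : 0 <= l2norm x. Proof. exact: sqrtr_ge0. Qed.

Lemma l2norm_sqr x : l2norm x ^+ 2 = \sum_i rnorm (x i) ^+ 2.
Proof. by rewrite sqr_sqrtr// sumr_ge0// => i _; rewrite sqr_ge0. Qed.

Lemma l2normZ (c : R[i]) x : l2norm (fun i => c *: x i) = rnorm c * l2norm x.
Proof.
rewrite /l2norm -[X in X * _]ger0_norm ?rnorm_ge0// -sqrtr_sqr.
rewrite -sqrtrM ?sqr_ge0//; congr Num.sqrt; rewrite mulr_sumr.
by apply: eq_bigr => i _; rewrite rnormZ exprMn.
Qed.

Lemma rnorm_le_l2norm x i : rnorm (x i) <= l2norm x.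
Proof.
rewrite -ler_sqr ?nnegrE ?rnorm_ge0 ?l2norm_ge0// l2norm_sqr (bigD1 i)//=.
by rewrite lerDl sumr_ge0// => j _; rewrite sqr_ge0.
Qed.

Lemma l2norm_le_sum x : l2norm x <= \sum_i rnorm (x i).
Proof.
have S0 : 0 <= \sum_i rnorm (x i) by apply: sumr_ge0 => i _; exact: rnorm_ge0.
rewrite -ler_sqr ?nnegrE ?l2norm_ge0// l2norm_sqr sum_sqr_le// => i.
exact: rnorm_ge0.
Qed.

Lemma mx_opnorm_has_sup T :
  has_sup [set l2norm (mx_app T x) | x in [set x | l2norm x <= 1]].
Proof.
split.
  exists (l2norm (mx_app T (fun=> 0))), (fun=> 0) => //=.
  rewrite /l2norm big1 ?sqrtr0 ?ler01// => i _.
  by rewrite rnorm0 expr0n.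
exists (\sum_i \sum_j opnorm (T i j)) => _ [x /= x1 <-].
apply: le_trans (l2norm_le_sum _) _; apply: ler_sum => i _.
apply: le_trans (rnorm_sum _) _; apply: ler_sum => j _.
by apply: opnorm_ub; apply: le_trans x1; exact: rnorm_le_l2norm.
Qed.

Lemma mx_opnorm_ub T x : l2norm x <= 1 -> l2norm (mx_app T x) <= mx_opnorm T.
Proof.
by move=> x1; apply: sup_upper_bound (mx_opnorm_has_sup T) _ _; exists x.
Qed.

Lemma mx_opnorm_le T (M : R) :
  (forall x, l2norm x <= 1 -> l2norm (mx_app T x) <= M) -> mx_opnorm T <= M.
Proof.
move=> TM; apply: ge_sup; first by case: (mx_opnorm_has_sup T).
by move=> _ [x /= x1 <-]; exact: TM.
Qed.

Lemma mx_opnorm_ge0 T : 0 <= mx_opnorm T.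
Proof.
apply: le_trans (l2norm_ge0 (mx_app T (fun=> 0))) (mx_opnorm_ub _ _).
by rewrite /l2norm big1 ?sqrtr0 ?ler01// => i _; rewrite rnorm0 expr0n.
Qed.

Lemma mx_opnorm_bound T x : l2norm (mx_app T x) <= mx_opnorm T * l2norm x.
Proof.
have [x0|x0] := leP (l2norm x) 0.
  have xi i : x i = 0.
    apply: rnorm_eq0; apply/eqP; rewrite eq_le rnorm_ge0 andbT.
    exact: le_trans (rnorm_le_l2norm x i) x0.
  rewrite [X in X <= _](_ : _ = 0) ?mulr_ge0 ?mx_opnorm_ge0 ?l2norm_ge0//.
  rewrite /l2norm big1 ?sqrtr0// => i _.
  by rewrite /mx_app big1 ?rnorm0 ?expr0n// => j _; rewrite xi linear0.
have c0 : 0 <= (l2norm x)^-1 by rewrite invr_ge0 l2norm_ge0.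
rewrite -ler_pdivrMr// mulrC.
have <- : l2norm (mx_app T (fun i => (l2norm x)^-1%:C *: x i)) =
    (l2norm x)^-1 * l2norm (mx_app T x).
  rewrite -[X in X * _]ger0_norm// -rnorm_real -l2normZ; congr l2norm.
  apply/funext => i; rewrite /mx_app scaler_sumr.
  by apply: eq_bigr => j _; rewrite linearZ.
apply: mx_opnorm_ub.
by rewrite l2normZ rnorm_real ger0_norm// mulVf ?gt_eqF.
Qed.

End MatrixNorm.

(** * Subspaces, Hilbert sums and coordinate spaces *)

Section Subspace.
Variables (R : realType) (H : finHilbertType R) (U : {vspace H}).

Definition sub_inner (x y : subvs_of U) : R[i] := inner (vsval x) (vsval y).

Let sub_inner_bilinear :
  bilinear_for (GRing.Scale.Law.clone _ _ *%R _)
    (GRing.Scale.Law.clone _ _ (@Num.Def.conjC R[i] \; *%R) _) sub_inner.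
Proof.
by split=> [y c x x'|x c y y']; rewrite /sub_inner linearP/= ?linearPl ?linearPr.
Qed.

HB.instance Definition _ :=
  bilinear_isBilinear.Build R[i] _ _ _ _ _ sub_inner sub_inner_bilinear.

Let sub_inner_herm x y :
  sub_inner x y = (-1) ^+ false * (sub_inner y x)^*%C.
Proof. by rewrite /sub_inner expr0 mul1r -inner_conj. Qed.

HB.instance Definition _ :=
  isHermitianSesquilinear.Build R[i] _ false (@Num.Def.conjC R[i])
    sub_inner sub_inner_herm.

Let sub_inner_gt0 x : x != 0 -> 0 < sub_inner x x.
Proof. by move=> x0; rewrite /sub_inner dnorm_gt0 (inj_eq val_inj x 0). Qed.

HB.instance Definition _ :=
  isDotProduct.Build R[i] _ sub_inner sub_inner_gt0.

Definition sub_hilbert : finHilbertType R := ip_space sub_inner.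

End Subspace.

Section DirectSum.
Variables (R : realType) (H1 H2 : finHilbertType R).

Definition sum_inner (x y : H1 * H2) : R[i] := inner x.1 y.1 + inner x.2 y.2.

Let sum_inner_bilinear :
  bilinear_for (GRing.Scale.Law.clone _ _ *%R _)
    (GRing.Scale.Law.clone _ _ (@Num.Def.conjC R[i] \; *%R) _) sum_inner.
Proof.
split=> [y c x x'|x c y y']; rewrite /sum_inner/=.
  by rewrite !linearPl/= mulrDr addrACA.
by rewrite !linearPr/= mulrDr addrACA.
Qed.

HB.instance Definition _ :=
  bilinear_isBilinear.Build R[i] _ _ _ _ _ sum_inner sum_inner_bilinear.

Let sum_inner_herm x y :
  sum_inner x y = (-1) ^+ false * (sum_inner y x)^*%C.
Proof. by rewrite /sum_inner expr0 mul1r rmorphD/= -!inner_conj. Qed.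

HB.instance Definition _ :=
  isHermitianSesquilinear.Build R[i] _ false (@Num.Def.conjC R[i])
    sum_inner sum_inner_herm.

Let sum_inner_gt0 x : x != 0 -> 0 < sum_inner x x.
Proof.
case: x => x y xy0; rewrite /sum_inner/= lt_def addr_ge0// andbT.
by rewrite paddr_eq0// !dnorm_eq0.
Qed.

HB.instance Definition _ :=
  isDotProduct.Build R[i] _ sum_inner sum_inner_gt0.

Definition sum_hilbert : finHilbertType R := ip_space sum_inner.

End DirectSum.

Section Coordinates.
Variables (R : realType) (n : nat).

Definition row_inner (u v : 'rV[R[i]]_n) : R[i] := \sum_j u 0 j * (v 0 j)^*.

Let row_inner_bilinear :
  bilinear_for (GRing.Scale.Law.clone _ _ *%R _)
    (GRing.Scale.Law.clone _ _ (@Num.Def.conjC R[i] \; *%R) _) row_inner.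
Proof.
split=> [y c x x'|x c y y']; rewrite /row_inner/= mulr_sumr -big_split;
  apply: eq_bigr => j _; rewrite !mxE/=; first by rewrite mulrDl mulrA.
by rewrite rmorphD rmorphM mulrDr mulrCA.
Qed.

HB.instance Definition _ :=
  bilinear_isBilinear.Build R[i] _ _ _ _ _ row_inner row_inner_bilinear.

Let row_inner_herm x y :
  row_inner x y = (-1) ^+ false * (row_inner y x)^*%C.
Proof.
rewrite /row_inner expr0 mul1r rmorph_sum; apply: eq_bigr => j _.
by rewrite rmorphM /= conjcK mulrC.
Qed.

HB.instance Definition _ :=
  isHermitianSesquilinear.Build R[i] _ false (@Num.Def.conjC R[i])
    row_inner row_inner_herm.

Let row_inner_gt0 x : x != 0 -> 0 < row_inner x x.
Proof.
have sq j : 0 <= x 0 j * (x 0 j)^* by rewrite -sqr_normc exprn_ge0.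
move=> x0; rewrite lt_def sumr_ge0 ?andbT//.
apply: contra x0 => /eqP/psumr_eq0P x0; apply/eqP/rowP => j; apply/eqP.
by rewrite mxE -normr_eq0 -sqrf_eq0 sqr_normc x0.
Qed.

HB.instance Definition _ :=
  isDotProduct.Build R[i] _ row_inner row_inner_gt0.

Definition row_hilbert : finHilbertType R := ip_space row_inner.

Lemma coord_norm_sqr (u : row_hilbert) :
  rnorm u ^+ 2 = \sum_j rnorm ((u : 'rV_n) 0 j) ^+ 2.
Proof.
rewrite -Re_inner_norm -[inner _ _]/(row_inner _ _) raddf_sum.
apply: eq_bigr => j _.
by rewrite -sqr_normc -rnormE -rmorphXn.
Qed.

Lemma coord_norm_le (u : row_hilbert) j : rnorm ((u : 'rV_n) 0 j) <= rnorm u.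
Proof.
rewrite -ler_sqr ?nnegrE ?rnorm_ge0// coord_norm_sqr (bigD1 j)//=.
by rewrite lerDl sumr_ge0// => i _; rewrite sqr_ge0.
Qed.

Lemma norm_le_sum_coord (u : row_hilbert) :
  rnorm u <= \sum_j rnorm ((u : 'rV_n) 0 j).
Proof.
have S0 : 0 <= \sum_j rnorm ((u : 'rV_n) 0 j).
  by apply: sumr_ge0 => j _; exact: rnorm_ge0.
rewrite -ler_sqr ?nnegrE ?rnorm_ge0// coord_norm_sqr sum_sqr_le// => j.
exact: rnorm_ge0.
Qed.

End Coordinates.

(** * Completely contractive representations *)

Section Representations.
Variables (R : realType) (K : hilbertType R) (A : unitalOperatorAlgebra K).

Section CompleteContractivity.
Variables (H : hilbertType R) (pi : A -> bop H).

Lemma cc_bound : completely_contractive pi -> forall n (T : 'M[A]_n) x,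
  l2norm (mx_app (map_mx pi T) x) <=
  mx_opnorm (map_mx (@opalg_val R K A) T) * l2norm x.
Proof.
move=> pi_cc n T x; apply: le_trans (mx_opnorm_bound _ _) _.
by rewrite ler_wpM2r ?l2norm_ge0.
Qed.

Lemma cc_intro : (forall n (T : 'M[A]_n) x,
    l2norm (mx_app (map_mx pi T) x) <=
    mx_opnorm (map_mx (@opalg_val R K A) T) * l2norm x) ->
  completely_contractive pi.
Proof.
move=> pi_bd n T; apply: mx_opnorm_le => x x1; apply: le_trans (pi_bd _ _ _) _.
by rewrite ler_piMr// mx_opnorm_ge0.
Qed.

Lemma l2norm_ord1 (L : hilbertType R) (x : 'I_1 -> L) : l2norm x = rnorm (x ord0).
Proof. by rewrite /l2norm big_ord1 sqrtr_sqr ger0_norm// rnorm_ge0. Qed.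

Lemma cc_contractive : completely_contractive pi ->
  forall a : A, opnorm (pi a) <= opnorm a.
Proof.
move=> pi_cc a; apply: opnorm_le => x x1.
have := cc_bound pi_cc (const_mx a : 'M[A]_1) (fun=> x).
rewrite !l2norm_ord1 /mx_app big_ord1 !mxE => /le_trans; apply.
apply: (@le_trans _ _
  (mx_opnorm (map_mx (@opalg_val R K A) (const_mx a : 'M[A]_1)))).
  by rewrite ler_piMr// mx_opnorm_ge0.
apply: mx_opnorm_le => y; rewrite !l2norm_ord1 => y1.
by rewrite /mx_app big_ord1 !mxE; exact: opnorm_ub.
Qed.

End CompleteContractivity.

(** The matrices of a restriction act as those of the representation itself, on
    vectors whose entries lie in the subspace. *)
Lemma rep_restrict (H : finHilbertType R) (pi : A -> bop H)
    (U : {vspace H}) :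
  algebra_hom pi -> completely_contractive pi ->
  (forall a x, x \in U -> pi a x \in U) ->
  exists pi' : A -> bop (sub_hilbert U),
    [/\ algebra_hom pi', completely_contractive pi' &
        forall a x, vsval (pi' a x) = pi a (vsval x)].
Proof.
move=> [pi_lin piM] pi_cc piU.
have rnormU (x : sub_hilbert U) : rnorm x = rnorm (vsval x).
  apply/eqP; rewrite -(@eqrXn2 _ 2%N) ?rnorm_ge0//.
  by rewrite -!Re_inner_norm.
have jP c (x y : sub_hilbert U) : vsval (c *: x + y) = c *: vsval x + vsval y.
  exact: (@linearP _ _ _ _ (@vsval _ _ U)).
have ex_pi a : exists b : bop (sub_hilbert U),
    forall x, vsval (b x) = pi a (vsval x).
  pose f (x : sub_hilbert U) : sub_hilbert U := vsproj U (pi a (vsval x)).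
  have fE x : vsval (f x) = pi a (vsval x).
    by rewrite /f vsprojK// piU// subvsP.
  have f_lin : linear f.
    by move=> c x y; apply: val_inj; rewrite /= fE !linearP/= !fE.
  have f_bd x : rnorm (f x) <= opnorm (pi a) * rnorm x.
    by rewrite !rnormU fE opnorm_bound.
  by have [b bE] := ex_bop f_lin f_bd; exists b => x; rewrite bE.
have [pi' pi'E] := choice ex_pi; exists pi'; split=> //.
- split=> [c a b|a b]; apply: bop_ext => x; apply: val_inj.
    transitivity (c *: pi a (vsval x) + pi b (vsval x)).
      by rewrite [LHS]pi'E pi_lin.
    by rewrite -!pi'E -jP; congr (vsval _).
  by rewrite [LHS]pi'E piM [RHS]pi'E pi'E.
- apply: cc_intro => n T x.
  have -> : l2norm (mx_app (map_mx pi' T) x) =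
      l2norm (mx_app (map_mx pi T) (fun i => vsval (x i))).
    congr Num.sqrt; apply: eq_bigr => i _; rewrite rnormU linear_sum/=.
    by congr (rnorm _ ^+ 2); apply: eq_bigr => j _; rewrite !mxE pi'E.
  have -> : l2norm x = l2norm (fun i => vsval (x i)).
    by congr Num.sqrt; apply: eq_bigr => i _; rewrite rnormU.
  exact: cc_bound.
Qed.

(** Squared norms add up over the two summands, so a bound that holds for both
    representations holds for their sum with the same constant. *)
Lemma rep_direct_sum (H1 H2 : finHilbertType R)
    (pi1 : A -> bop H1) (pi2 : A -> bop H2) :
  algebra_hom pi1 -> completely_contractive pi1 ->
  algebra_hom pi2 -> completely_contractive pi2 ->
  exists pi : A -> bop (sum_hilbert H1 H2),
    [/\ algebra_hom pi, completely_contractive pi &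
        forall a x, pi a x = (pi1 a x.1, pi2 a x.2)].
Proof.
move=> [pi1_lin pi1M] pi1_cc [pi2_lin pi2M] pi2_cc.
have rnormS (x : sum_hilbert H1 H2) :
    rnorm x ^+ 2 = rnorm x.1 ^+ 2 + rnorm x.2 ^+ 2.
  by rewrite -!Re_inner_norm -raddfD.
have ex_pi a : exists b : bop (sum_hilbert H1 H2),
    forall x, b x = (pi1 a x.1, pi2 a x.2).
  pose f (x : sum_hilbert H1 H2) : sum_hilbert H1 H2 := (pi1 a x.1, pi2 a x.2).
  have f_lin : linear f by move=> c x y; rewrite /f /= !linearP.
  have f_bd x : rnorm (f x) <= opnorm a * rnorm x.
    have M0 : 0 <= opnorm a := opnorm_ge0 _.
    rewrite -ler_sqr ?nnegrE ?mulr_ge0 ?rnorm_ge0// exprMn !rnormS.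
    rewrite mulrDr -!exprMn.
    apply: lerD; rewrite ler_sqr ?nnegrE ?mulr_ge0 ?rnorm_ge0//;
      apply: le_trans (opnorm_bound _ _) _;
      rewrite ler_wpM2r ?rnorm_ge0//; exact: cc_contractive.
  exact: ex_bop f_lin f_bd.
have [pi piE] := choice ex_pi; exists pi; split=> //.
- split=> [c a b|a b]; apply: bop_ext => x.
    by rewrite piE pi1_lin pi2_lin /= !fctE/= !piE.
  by rewrite piE pi1M pi2M /= !piE.
- apply: cc_intro => n T x.
  set M := mx_opnorm _; have M0 : 0 <= M := mx_opnorm_ge0 _.
  rewrite -ler_sqr ?nnegrE ?mulr_ge0 ?l2norm_ge0//.
  have l2normS (y : 'I_n -> sum_hilbert H1 H2) : l2norm y ^+ 2 =
      l2norm (fun i => (y i).1) ^+ 2 + l2norm (fun i => (y i).2) ^+ 2.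
    by rewrite !l2norm_sqr -big_split; apply: eq_bigr => i _; exact: rnormS.
  rewrite exprMn !l2normS mulrDr -!exprMn.
  have -> : (fun i => (mx_app (map_mx pi T) x i).1) =
      mx_app (map_mx pi1 T) (fun i => (x i).1).
    apply/funext => i; rewrite /mx_app (raddf_sum (@fst H1 H2)).
    by apply: eq_bigr => j _; rewrite !mxE piE.
  have -> : (fun i => (mx_app (map_mx pi T) x i).2) =
      mx_app (map_mx pi2 T) (fun i => (x i).2).
    apply/funext => i; rewrite /mx_app (raddf_sum (@snd H1 H2)).
    by apply: eq_bigr => j _; rewrite !mxE piE.
  by apply: lerD; rewrite ler_sqr ?nnegrE ?mulr_ge0 ?l2norm_ge0// cc_bound.
Qed.

End Representations.
(** * Finite dimensional states *)

Section States.
Variables (R : realType) (K : hilbertType R) (A : unitalOperatorAlgebra K).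
Implicit Types (a b : A) (phi psi : A -> R[i]).

Lemma state_rnorm phi a : @state_space R K A phi -> rnorm (phi a) <= opnorm a.
Proof. by case=> _ _ /(_ a); rewrite bop_normE -rnormE lecR. Qed.

Lemma opnorm1_le : opnorm (1 : A) <= 1.
Proof. by apply: opnorm_le. Qed.

Lemma scalar_sum phi (I : finType) (c : I -> R[i]) (x : I -> A) : scalar phi ->
  phi (\sum_i c i *: x i) = \sum_i c i * phi (x i).
Proof.
move=> phi_lin.
pose phim := GRing.isLinear.Build R[i] A R[i] _ phi phi_lin.
pose Phi : {scalar A} := HB.pack phi phim.
rewrite -[phi]/(Phi : A -> R[i]) linear_sum.
by apply: eq_bigr => i _; rewrite linearZ.
Qed.

Lemma vector_state (H : hilbertType R) (pi : A -> bop H) (xi : H) :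
  algebra_hom pi -> (forall a, opnorm (pi a) <= opnorm a) -> pi 1 xi = xi ->
  rnorm xi = 1 ->
  @state_space R K A (fun a => inner (pi a xi) xi).
Proof.
move=> [pi_lin piM] pi_le pi1 xi1; split.
- move=> c a b; rewrite pi_lin.
  by rewrite -[X in inner X _]/(c *: pi a xi + pi b xi) linearPl.
- by rewrite pi1 inner_norm -rnormE xi1 expr1n.
- move=> a; rewrite bop_normE -rnormE lecR (le_trans (inner_le _ _))// xi1 mulr1.
  by rewrite (le_trans (opnorm_bound _ _))// xi1 mulr1.
Qed.

(** When [pi] is not unital, its restriction to the range of the idempotent
    [pi 1], which consists of the vectors fixed by [pi 1], is. *)
Lemma fd_state_of_fixed_vector (H : finHilbertType R) (pi : A -> bop H) (xi : H) :
  algebra_hom pi -> completely_contractive pi -> pi 1 xi = xi ->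
  rnorm xi = 1 ->
  @finite_dimensional_state R K A (fun a => inner (pi a xi) xi).
Proof.
move=> pi_hom pi_cc pi1 xi1; have [pi_lin piM] := pi_hom; split.
  by apply: vector_state => //; exact: cc_contractive.
pose U := lker (linfun (pi 1) - \1)%VF.
have memU x : (x \in U) = (pi 1 x == x).
  by rewrite memv_ker add_lfunE opp_lfunE id_lfunE lfunE subr_eq0.
have piU a x : x \in U -> pi a x \in U.
  move=> _; rewrite memU; apply/eqP.
  by rewrite -[in RHS](mul1r a) piM.
have [pi' [pi'_hom pi'_cc pi'E]] := rep_restrict pi_hom pi_cc piU.
have xiU : xi \in U by rewrite memU pi1.
pose xi' : sub_hilbert U := vsproj U xi.
have xi'E : vsval xi' = xi by rewrite vsprojK.
exists (sub_hilbert U), pi', xi'; split => //.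
- apply: bop_ext => x; apply: val_inj; rewrite [LHS]pi'E.
  by apply/eqP; rewrite -memU subvsP.
- have : rnorm xi' ^+ 2 = 1.
    by rewrite -Re_inner_norm -[inner _ _]/(inner (vsval xi') (vsval xi'))
       xi'E Re_inner_norm xi1 expr1n.
  move/eqP; rewrite sqrp_eq1 ?rnorm_ge0// => /eqP h.
  by rewrite -rnormE h.
- move=> a; rewrite -[RHS]/(inner (vsval (pi' a xi')) (vsval xi')).
  by rewrite pi'E xi'E.
Qed.

(** A convex combination is the vector state of the Hilbert sum at
    [(sqrt t x1, sqrt (1 - t) x2)]. *)
Lemma fd_state_convex phi psi (t : R) : 0 <= t <= 1 ->
  @finite_dimensional_state R K A phi -> @finite_dimensional_state R K A psi ->
  @finite_dimensional_state R K A (fun a => t%:C * phi a + (1 - t)%:C * psi a).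
Proof.
move=> /andP[t0 t1] [_ [H1 [pi1 [x1 [hom1 cc1 u1 n1 E1]]]]].
move=> [_ [H2 [pi2 [x2 [hom2 cc2 u2 n2 E2]]]]].
have [pi [pi_hom pi_cc piE]] := rep_direct_sum hom1 cc1 hom2 cc2.
have t1' : 0 <= 1 - t by rewrite subr_ge0.
pose c := (Num.sqrt t)%:C; pose d := (Num.sqrt (1 - t))%:C.
have sqrtE (x : R) : 0 <= x -> (Num.sqrt x)%:C * (Num.sqrt x)%:C^* = x%:C.
  move=> x0; rewrite -sqr_normc -rnormE rnorm_real ger0_norm ?sqrtr_ge0//.
  by rewrite -rmorphXn /= sqr_sqrtr.
have cE : c * c^* = t%:C := sqrtE _ t0.
have dE : d * d^* = (1 - t)%:C := sqrtE _ t1'.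
pose xi : sum_hilbert H1 H2 := (c *: x1, d *: x2).
have innerE a : inner (pi a xi) xi = t%:C * phi a + (1 - t)%:C * psi a.
  rewrite piE -[LHS]/(inner (pi1 a (c *: x1)) (c *: x1) +
    inner (pi2 a (d *: x2)) (d *: x2)).
  rewrite [pi1 a _]linearZ [pi2 a _]linearZ !innerZZ cE dE.
  by rewrite E1 E2.
have -> : (fun a => t%:C * phi a + (1 - t)%:C * psi a) =
    (fun a => inner (pi a xi) xi).
  by apply/funext => a; rewrite innerE.
apply: fd_state_of_fixed_vector => //.
- by rewrite piE [pi1 1 _]linearZ [pi2 1 _]linearZ u1 u2.
- have : rnorm xi ^+ 2 = 1.
    rewrite -Re_inner_norm.
    rewrite -[inner xi xi]/(inner (c *: x1) (c *: x1) + inner (d *: x2) (d *: x2)).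
    rewrite !innerZZ cE dE !inner_norm n1 n2 expr1n !mulr1.
    by rewrite -rmorphD /= subrKC.
  by move/eqP; rewrite sqrp_eq1 ?rnorm_ge0// => /eqP.
Qed.

End States.

(** * Density of the finite dimensional states *)

Lemma nbhs_rnorm (R : realType) (z : R[i]) (e : R) : 0 < e ->
  nbhs z [set w | rnorm (w - z) < e].
Proof.
move=> e0; apply/(@nbhs_normP _ (R[i]^o)); exists e%:C; first by rewrite /= ltcR.
by move=> w /=; rewrite rnorm_distC -rnormE ltcR.
Qed.

Lemma nbhs_rnormP (R : realType) (z : R[i]) (B : set R[i]) : nbhs z B ->
  exists2 e : R, 0 < e & [set w | rnorm (w - z) < e] `<=` B.
Proof.
move/(@nbhs_normP _ (R[i]^o)) => [e /= e0 eB].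
exists (complex.Re e); first by rewrite -ltcR RRe_real// gtr0_real.
move=> w /= we; apply: eB => /=; rewrite -opprB normrN -rnormE.
by rewrite -[e]RRe_real ?ltcR// gtr0_real.
Qed.

Section Ptws.
Variables (R : realType) (X : choiceType) (E : set {ptws X -> R[i]}).

Lemma ptws_closure_dist (phi : {ptws X -> R[i]}) (a : X) (e : R) :
  0 < e -> closure E phi -> exists2 psi, E psi & rnorm (psi a - phi a) < e.
Proof.
move=> e0 /(_ [set psi | rnorm (psi a - phi a) < e]) [].
  apply: (@proj_continuous X (fun=> R[i]) a phi [set z | rnorm (z - phi a) < e]).
  exact: nbhs_rnorm.
by move=> psi [Epsi psia]; exists psi.
Qed.

(** The sets of members of [E] that are [e]-close to [phi] on the finite set [s]
    form a filter base, which converges to [phi] as it does so at each point. *)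
Lemma ptws_closure_intro (phi : {ptws X -> R[i]}) :
  (forall (s : seq X) (e : R), 0 < e ->
     exists2 psi, E psi & {in s, forall a, rnorm (psi a - phi a) < e}) ->
  closure E phi.
Proof.
move=> Eappr.
pose D := [set p : seq X * R | 0 < p.2].
pose B (p : seq X * R) := [set psi : {ptws X -> R[i]} | E psi /\
   {in p.1, forall a, rnorm (psi a - phi a) < p.2}].
have FB : Filter (filter_from D B).
  apply: filter_from_filter; first by exists ([::], 1); rewrite /D /=.
  move=> [s e] [s' e'] /= e0 e0'; exists (s ++ s', Num.min e e').
    by rewrite /D /= lt_min e0 e0'.
  move=> psi [Epsi psiP]; split; split=> // a /= sa.
    by have := psiP a; rewrite mem_cat sa lt_min /= => /(_ isT)/andP[].
  by have := psiP a; rewrite mem_cat sa orbT lt_min /= => /(_ isT)/andP[].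
have PB : ProperFilter (filter_from D B).
  apply: filter_from_proper => // -[s e] /= e0.
  by have [psi Epsi psiP] := Eappr s e e0; exists psi.
rewrite closureEcvg /=; exists (filter_from D B) => //; split; last first.
  move=> S ES; exists ([::], 1); first by rewrite /D /=.
  by move=> psi [Epsi _]; exact: ES.
apply/cvg_sup => a S; rewrite nbhsE => -[_ [[Q oQ <-] Qphi] QS].
have [e e0 eQ] := nbhs_rnormP (open_nbhs_nbhs (conj oQ Qphi)).
exists ([:: a], e) => // psi [_ psiP]; apply: QS; apply: eQ.
by apply: psiP; rewrite mem_head.
Qed.

End Ptws.

Section ConvexSeparation.
Variables (R : realType) (H : hilbertType R).

(** If no linear functional separates [v] from the bounded convex set [S], then
    [v] is in the closure of [S].  Were the squared distance [q] from [v] to [S]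
    positive, take [w] in [S] nearly at that distance and [u] in [S] that is not
    separated from [v] in the direction [v - w]: moving from [w] towards [u]
    brings the squared distance to [v] below [q].  With approximate minimizers
    no compactness is needed, and the dimension may be infinite. *)
Lemma convex_approx (S : set H) (v : H) (M : R) :
  (forall u w (t : R), S u -> S w -> 0 <= t <= 1 ->
     S (w + t%:C *: (u - w))) ->
  (forall u, S u -> rnorm u <= M) ->
  (forall y (d : R), 0 < d -> exists2 u, S u &
     complex.Re (inner (v - u) y) < d) ->
  forall e : R, 0 < e -> exists2 u, S u & rnorm (u - v) < e.
Proof.
move=> S_convex S_bounded S_sep e e0; apply: contrapT => S_far.
pose Q := [set rnorm (v - u) ^+ 2 | u in S].
have Q_lb : lbound Q (e ^+ 2).
  move=> _ [u Su <-]; rewrite ler_sqr ?nnegrE ?rnorm_ge0 ?(ltW e0)// leNgt.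
  by apply/negP => uv; apply: S_far; exists u => //; rewrite rnorm_distC.
have Q0 : Q !=set0.
  by have [u Su _] := S_sep 0 1 ltr01; exists (rnorm (v - u) ^+ 2), u.
have Q_inf : has_inf Q by split=> //; exists (e ^+ 2).
pose q := inf Q; have q0 : 0 < q.
  by apply: lt_le_trans (lb_le_inf Q0 Q_lb); rewrite exprn_gt0.
have M0 : 0 <= M.
  by case: Q0 => _ [u Su _]; apply: le_trans (S_bounded _ Su); exact: rnorm_ge0.
pose D := (M + M) ^+ 2; have D0 : 0 <= D by rewrite sqr_ge0.
(* small enough for the quadratic term t^2 D to cost at most t q / 2, and at
   most 1 *)
pose t := q / (D + D + q).
have DDq0 : 0 < D + D + q by rewrite ltr_wpDl// addr_ge0.
have t0 : 0 < t by rewrite divr_gt0.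
have t1 : t <= 1 by rewrite ler_pdivrMr// mul1r lerDr addr_ge0.
have tD : t * D <= q / 2.
  rewrite /t mulrAC ler_pdivrMr// mulrAC ler_pdivlMr// -mulrA.
  by rewrite ler_pM2l// mulr_natr mulr2n lerDl ltW.
have [_ [w Sw <-] wq] : exists2 x, Q x & x < q + t * q / 2.
  by apply: inf_adherent => //; rewrite divr_gt0// mulr_gt0.
have q_le u : S u -> q <= rnorm (v - u) ^+ 2.
  by move=> Su; apply: ge_inf; [exists (e ^+ 2)|exists u].
have q2 : 0 < q / 4 by rewrite divr_gt0.
have [u Su uw] := S_sep (v - w) _ q2.
have uw_re : q - q / 4 < complex.Re (inner (u - w) (v - w)).
  have -> : u - w = (v - w) - (v - u) by rewrite opprB [RHS]addrC addrA subrK.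
  rewrite linearBl raddfB /= Re_inner_norm.
  by have := q_le _ Sw; move: uw; lra.
have Du : rnorm (u - w) ^+ 2 <= D.
  rewrite ler_sqr ?nnegrE ?rnorm_ge0 ?addr_ge0//.
  by rewrite (le_trans (rnormB _ _))// lerD// S_bounded.
have t01 : 0 <= t <= 1 by rewrite (ltW t0) t1.
have := q_le _ (S_convex u w t Su Sw t01); apply/negP; rewrite -ltNge.
have -> : v - (w + t%:C *: (u - w)) = (- t)%:C *: (u - w) + (v - w).
  by rewrite rmorphN scaleNr opprD addrA [RHS]addrC.
rewrite rnormD_sqr rnormZ rnorm_real normrN (gtr0_norm t0) exprMn.
have -> : complex.Re (inner ((- t)%:C *: (u - w)) (v - w)) =
    - t * complex.Re (inner (u - w) (v - w)).
  by rewrite linearZl_LR Re_scale.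
move: wq uw_re Du tD t0 q0.
set X := rnorm (u - w) ^+ 2; set Y := rnorm (v - w) ^+ 2.
set Z := complex.Re _ => wq uw_re Du tD t0' q0'.
have h1 : t ^+ 2 * X <= t * (q / 2).
  rewrite expr2 -mulrA ler_pM2l//; apply: le_trans tD.
  by rewrite ler_pM2l.
have h2 : t * (q - q / 4) < t * Z by rewrite ltr_pM2l.
have tq : 0 < t * q by rewrite mulr_gt0.
lra.
Qed.

End ConvexSeparation.

Section Dense.
Variables (R : realType) (K : hilbertType R) (A : unitalOperatorAlgebra K).
Implicit Types (a b : A) (phi psi : A -> R[i]).
Local Notation fd_state := (@finite_dimensional_state R K A).

(** Two states are close on the finite list [s] when their vectors of values
    are close in [C^n], and the linear functionals on [C^n] are the evaluations
    at the linear combinations of [s]. *)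
Lemma num_range_dense phi :
  @state_space R K A phi ->
  (forall a (d : R), 0 < d -> exists2 psi, fd_state psi &
     complex.Re (phi a) - complex.Re (psi a) < d) ->
  closure fd_state phi.
Proof.
move=> phi_state phi_num; apply: ptws_closure_intro => s e e0.
pose n := size s; pose Cn := row_hilbert R n.
pose v psi : Cn := \row_(i < n) psi s`_i.
have vE psi (i : 'I_n) : (v psi : 'rV_n) 0 i = psi s`_i by rewrite mxE.
pose S : set Cn := [set v psi | psi in fd_state].
have dotE psi (y : Cn) : @state_space R K A psi ->
    inner (v psi) y = psi (\sum_i ((y : 'rV_n) 0 i)^* *: s`_i).
  case=> psi_lin _ _; rewrite (scalar_sum _ _ psi_lin).
  rewrite -[LHS]/(row_inner (v psi) y).
  by apply: eq_bigr => i _; rewrite vE mulrC.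
have [|||_ [psi psi_fd <-] psi_e] := @convex_approx R Cn S (v phi)
  (\sum_(i < n) opnorm (s`_i : A)) _ _ _ e e0.
- move=> _ _ t [psi1 psi1S <-] [psi2 psi2S <-] t01.
  exists (fun a => t%:C * psi1 a + (1 - t)%:C * psi2 a).
    exact: fd_state_convex.
  apply/rowP => i; rewrite !mxE rmorphB rmorph1.
  by ring.
- move=> _ [psi [psi_st _] <-]; apply: le_trans (norm_le_sum_coord _) _.
  by apply: ler_sum => i _; rewrite vE state_rnorm.
- move=> y d d0.
  have [psi psi_fd psi_d] := phi_num (\sum_i ((y : 'rV_n) 0 i)^* *: s`_i) d d0.
  exists (v psi); first by exists psi.
  by rewrite linearBl raddfB/= !dotE//; case: psi_fd.
exists psi => // a sa.
have ia : (index a s < n)%N by rewrite index_mem.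
have := coord_norm_le (v psi - v phi) (Ordinal ia).
rewrite !mxE /= nth_index// => /le_lt_trans; exact.
Qed.

(** Comparing [1 + t (Re (phi a) - d / 2) < `|pi (1 + t a) xi|] with the
    expansion of the square of the right hand side gives the result as soon as
    [t * opnorm a ^+ 2 <= d]; the left hand side is positive, so that squaring
    is allowed, when [t * (opnorm a + d) <= 1]. *)
Lemma num_range_approx phi a (d : R) :
  (forall a : A,
     opnorm a =
     sup [set r : R | exists (H : finHilbertType R) (pi : A -> bop H),
            [/\ algebra_hom pi, completely_contractive pi & r = opnorm (pi a)]]) ->
  @state_space R K A phi -> 0 < d ->
  exists2 psi, fd_state psi & complex.Re (phi a) - complex.Re (psi a) < d.
Proof.
move=> rep_norm phi_state d0; have [phi_lin phi1 _] := phi_state.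
have [H0 [pi0 [hom0 cc0]]] : exists (H : finHilbertType R) (pi : A -> bop H),
    algebra_hom pi /\ completely_contractive pi.
  (* otherwise the supremum of the empty set, 0, would be the norm of 1 *)
  apply: contrapT => no_rep; have := state_rnorm 1 phi_state.
  rewrite phi1 rep_norm (_ : [set _ | _] = set0) ?sup0.
    by rewrite /rnorm normr1 ler10.
  by apply/seteqP; split=> // r [H [pi [? ? _]]]; apply: no_rep; exists H, pi.
pose M := opnorm a; have M0 : 0 <= M by exact: opnorm_ge0.
pose D := M ^+ 2 + d * (M + d) + 1.
have D0 : 0 < D.
  by rewrite ltr_wpDl// addr_ge0 ?sqr_ge0// mulr_ge0 ?addr_ge0// ltW.
pose t := d / D; have t0 : 0 < t by rewrite divr_gt0.
have tM2 : t * M ^+ 2 <= d.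
  rewrite /t mulrAC ler_pdivrMr// ler_pM2l// /D -addrA lerDl.
  by rewrite addr_ge0// mulr_ge0 ?addr_ge0// ltW.
have tMd : t * (M + d) <= 1.
  rewrite /t mulrAC ler_pdivrMr// mul1r /D -[leRHS]addrA addrCA lerDl.
  by rewrite addr_ge0// sqr_ge0.
pose b : A := 1 + t%:C *: a.
have phib : phi b = 1 + t%:C * phi a.
  by rewrite /b addrC phi_lin phi1 addrC.
pose s := 1 + t * (complex.Re (phi a) - d / 2).
have phiaM : - M <= complex.Re (phi a).
  have := Re_rnorm (phi a); rewrite ler_norml => /andP[+ _].
  by apply: le_trans; rewrite lerN2; exact: state_rnorm.
have s0 : 0 < s.
  have : t * (- M - d / 2) <= t * (complex.Re (phi a) - d / 2).
    by rewrite ler_pM2l// lerB.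
  have : 0 < t * d by rewrite mulr_gt0.
  rewrite /s; nra.
have sb : s < opnorm b.
  apply: lt_le_trans (state_rnorm b phi_state).
  apply: lt_le_trans (le_trans (ler_norm _) (Re_rnorm _)).
  rewrite phib /s raddfD /= Re_scale ltrD2l.
  by rewrite ltr_pM2l// ltrBlDr ltrDl divr_gt0.
rewrite rep_norm in sb.
have [|_ [H [pi [pi_hom pi_cc ->]]] spi] := sup_gt _ sb.
  by exists (opnorm (pi0 b)), H0, pi0.
have [pi_lin piM] := pi_hom.
have [|_ [x /= x1 <-] sx] := sup_gt _ spi.
  by case: (opnorm_has_sup (pi b)).
(* pi c and pi c (pi 1) agree, so x may be moved into the range of pi 1 *)
pose y := pi 1 x.
have piy c : pi c y = pi c x by rewrite -[in RHS](mulr1 c) piM.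
have y1 : rnorm y <= 1.
  apply: le_trans (opnorm_ub _ x1) (le_trans (cc_contractive pi_cc 1) _).
  exact: opnorm1_le.
have y0 : 0 < rnorm y.
  rewrite rnorm_gt0; apply/eqP => y0; move: sx; rewrite -piy y0 linear0 rnorm0.
  by apply/negP; rewrite -leNgt ltW.
pose xi := (rnorm y)^-1%:C *: y.
have xi1 : rnorm xi = 1 by rewrite rnorm_normalize// -rnorm_gt0.
have pi1xi : pi 1 xi = xi by rewrite linearZ/= piy.
have s_xi : s < rnorm (pi b xi).
  rewrite linearZ/= piy rnormZ rnorm_real ger0_norm ?invr_ge0 ?rnorm_ge0//.
  by apply: lt_le_trans sx _; rewrite ler_peMl ?rnorm_ge0// invf_ge1.
exists (fun c => inner (pi c xi) xi); first exact: fd_state_of_fixed_vector.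
have pibE : pi b xi = t%:C *: pi a xi + xi.
  by rewrite /b addrC pi_lin -[LHS]/(t%:C *: pi a xi + pi 1 xi) pi1xi.
have : s ^+ 2 < rnorm (pi b xi) ^+ 2.
  by rewrite ltr_sqr ?nnegrE ?(ltW s0) ?rnorm_ge0.
rewrite pibE rnormD_sqr xi1 rnormZ rnorm_real (gtr0_norm t0).
have -> : complex.Re (inner (t%:C *: pi a xi) xi) =
    t * complex.Re (inner (pi a xi) xi).
  by rewrite linearZl_LR Re_scale.
have pia : rnorm (pi a xi) <= M.
  apply: le_trans (opnorm_bound _ _) _; rewrite xi1 mulr1.
  exact: cc_contractive.
have pia2 : t * (t * rnorm (pi a xi) ^+ 2) <= t * d.
  rewrite ler_pM2l//; apply: le_trans tM2; rewrite ler_pM2l//.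
  by rewrite ler_sqr ?nnegrE ?rnorm_ge0.
rewrite /s; set p := complex.Re _; set q := complex.Re _ => h.
rewrite -(ltr_pM2l t0).
have : 0 <= (t * (p - d / 2)) ^+ 2 by rewrite sqr_ge0.
move: h pia2; rewrite !expr2 -mulr_natl; nra.
Qed.

End Dense.

(** * Contractivity from positivity of the Cayley transform *)

Lemma le0_geometric (R : realType) (r C x : R) : 0 <= r < 1 -> 0 <= C ->
  (forall n, x <= C * r ^+ n) -> x <= 0.
Proof.
move=> /andP[r0 r1] C0 xC; rewrite leNgt; apply/negP => x0.
have C1 : 0 < C + 1 by rewrite ltr_wpDl.
have := @cvg_expr R r; rewrite ger0_norm// => /(_ r1)/cvgr_distC_lt.
move=> /(_ (x / (C + 1)) (divr_gt0 x0 C1))[n _ /(_ n (leqnn n)) /=].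
rewrite subr0 ger0_norm ?exprn_ge0// ltr_pdivlMr// => rn.
have := xC n; have : 0 <= r ^+ n by rewrite exprn_ge0.
by move: rn; nra.
Qed.

(** The formal identity [(1 + 2 (a + a^2 + ...)) (1 - a) = 1 + a], truncated. *)
Lemma cayley_partial_sum (Q : pzRingType) (a : Q) (n : nat) :
  (1 + (\sum_(k < n) a ^+ k.+1) *+ 2) * (1 - a) = 1 + a - a ^+ n.+1 *+ 2.
Proof.
elim: n => [|n IHn].
  by rewrite big_ord0 mul0rn addr0 mul1r expr1 mulr2n opprD addrA addrK.
rewrite big_ord_recr /= mulrnDl addrA mulrDl IHn mulrBr mulr1.
by rewrite mulrnAl -exprSr addrA subrK.
Qed.

Section Cayley.
Variables (R : realType) (K : hilbertType R) (A : unitalOperatorAlgebra K).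
Implicit Types (a : A) (phi psi : A -> R[i]).
Local Notation fd_state := (@finite_dimensional_state R K A).

Definition cayley_sum a n : A := 1 + (\sum_(k < n) a ^+ k.+1) *+ 2.

(** [<(1 + T) z, (1 - T) z>] has real part [`|z|^2 - `|T z|^2]. *)
Lemma Re_cayley_sum (H : hilbertType R) (pi : A -> bop H) a n (z : H) :
  algebra_hom pi -> pi 1 = 1 ->
  let y := z - pi a z in
  complex.Re (inner (pi (cayley_sum a n) y) y) =
  rnorm z ^+ 2 - rnorm (pi a z) ^+ 2 -
    complex.Re (inner (pi (a ^+ n.+1) z) y) *+ 2.
Proof.
move=> [pi_lin piM] pi1 y.
have piD b c x : pi (b + c) x = pi b x + pi c x.
  by have := pi_lin 1 b c; rewrite !scale1r => ->.
have piN b x : pi (- b) x = - pi b x.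
  have pi0 : pi 0 = 0 by have := pi_lin (-1) b b; rewrite !scaleN1r !addNr.
  by apply/eqP; rewrite -addr_eq0 -piD addNr pi0.
have -> : pi (cayley_sum a n) y = z + pi a z - pi (a ^+ n.+1) z *+ 2.
  have -> : y = pi (1 - a) z by rewrite piD piN pi1.
  rewrite -[LHS]/((pi (cayley_sum a n) * pi (1 - a)) z) -piM.
  by rewrite cayley_partial_sum mulr2n !piD piN piD pi1 mulr2n.
rewrite linearBl/= linearMnl raddfB raddfMn /=; congr (_ - _).
rewrite /y linearDl/= !linearBr/= !raddfD !raddfN /= !Re_inner_norm.
rewrite (Re_inner_sym z (pi a z)).
ring.
Qed.

End Cayley.

Section Contraction.
Variables (R : realType) (K : hilbertType R) (A : unitalOperatorAlgebra K).
Implicit Types (a b : A) (phi psi : A -> R[i]).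
Local Notation fd_state := (@finite_dimensional_state R K A).

Lemma rep_pow (H : hilbertType R) (pi : A -> bop H) a (r : R) n x :
  algebra_hom pi -> pi 1 = 1 -> 0 <= r -> opnorm (pi a) <= r ->
  rnorm (pi (a ^+ n) x) <= r ^+ n * rnorm x.
Proof.
move=> [_ piM] pi1 r0 pia; elim: n => [|n IHn]; first by rewrite !expr0 pi1 mul1r.
rewrite exprS piM -[X in X <= _]/(rnorm (pi a (pi (a ^+ n) x))).
apply: le_trans (opnorm_bound _ _) _.
by rewrite exprS -mulrA ler_pM// ?opnorm_ge0// rnorm_ge0.
Qed.

(** In finite dimension surjectivity follows from injectivity, which replaces
    the convergence of the Neumann series. *)
Lemma bop_surj_sub (H : finHilbertType R) (c : bop H) (r : R) (x : H) :
  r < 1 -> opnorm c <= r ->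
  exists2 z, x = z - c z & (1 - r) * rnorm z <= rnorm x.
Proof.
move=> r1 cr.
have c_le z : (1 - r) * rnorm z <= rnorm (z - c z).
  have := rnormD (z - c z) (c z); rewrite subrK.
  have := opnorm_bound c z; have := rnorm_ge0 z; move: cr; nra.
pose l := (\1 - linfun c)%VF.
have lE z : l z = z - c z by rewrite add_lfunE opp_lfunE id_lfunE lfunE.
have l0 : lker l == 0%VS.
  apply/lker0P => u v /eqP; rewrite -subr_eq0 -linearB/= lE => /eqP luv.
  apply/eqP; rewrite -subr_eq0; apply/eqP/rnorm_eq0; apply/eqP.
  rewrite eq_le rnorm_ge0 andbT -(@pmulr_rle0 _ (1 - r)) ?subr_gt0//.
  by rewrite (le_trans (c_le _))// luv rnorm0.
exists ((l^-1)%VF x); last first.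
  apply: le_trans (c_le _) _; rewrite -lE lker0_lfunVK//.
by rewrite -lE lker0_lfunVK.
Qed.

(** Stated so that it also covers [y = 0], where [phi] is any functional. *)
Lemma state_of_vector (y : K) : exists2 phi, y != 0 -> @state_space R K A phi &
  forall b, inner ((b : bop K) y) y = (rnorm y ^+ 2)%:C * phi b.
Proof.
have [->|y0] := eqVneq y 0.
  by exists (fun=> 0) => // b; rewrite linear0r mulr0.
have n0 : 0 < rnorm y by rewrite rnorm_gt0.
pose xi := (rnorm y)^-1%:C *: y.
have xi1 : rnorm xi = 1 by exact: rnorm_normalize.
exists (fun b => inner ((b : bop K) xi) xi).
  by move=> _; apply: (@vector_state _ _ _ _ (@opalg_val R K A)).
move=> b; have yE : y = (rnorm y)%:C *: xi.
  by rewrite scalerA -rmorphM mulfV ?gt_eqF// rmorph1 scale1r.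
have bE : (b : bop K) y = (rnorm y)%:C *: (b : bop K) xi by rewrite {1}yE linearZ.
rewrite bE [X in inner _ X]yE innerZZ -sqr_normc -rnormE rnorm_real.
by rewrite gtr0_norm// -rmorphXn.
Qed.

Hypothesis fd_dense : @state_space R K A `<=` closure fd_state.

Variables (a : A) (r : R).
Hypotheses (r0 : 0 <= r) (r1 : r < 1).
Hypothesis rep_a : forall (H : finHilbertType R) (pi : A -> bop H),
  algebra_hom pi -> completely_contractive pi -> opnorm (pi a) <= r.

Lemma state_pow phi n : @state_space R K A phi -> rnorm (phi (a ^+ n)) <= r ^+ n.
Proof.
move=> phi_st; apply/ler_addgt0Pr => e e0.
have [psi [_ [H [pi [xi [pi_hom pi_cc pi1 xi1 psiE]]]]] psi_e] :=
  ptws_closure_dist (a ^+ n) e0 (fd_dense phi_st).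
have {}xi1 : rnorm xi = 1 by rewrite /rnorm xi1.
have psi_le : rnorm (psi (a ^+ n)) <= r ^+ n.
  rewrite psiE; apply: le_trans (inner_le _ _) _; rewrite xi1 mulr1.
  have := rep_pow n xi pi_hom pi1 r0 (rep_a pi_hom pi_cc).
  by rewrite xi1 mulr1.
rewrite -[phi _](subKr (psi (a ^+ n))); apply: le_trans (rnormB _ _) _.
exact: lerD psi_le (ltW psi_e).
Qed.

(** In a finite dimensional representation [1 - pi a] is onto, so that
    [xi = z - pi a z] for a vector [z] of norm at most [1 / (1 - r)], and
    [Re_cayley_sum] applies; the bound passes to the limit. *)
Lemma state_cayley phi n : @state_space R K A phi ->
  - (2 * r ^+ n.+1 / (1 - r)) <= complex.Re (phi (cayley_sum a n)).
Proof.
move=> phi_st; apply/ler_addgt0Pr => e e0.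
have [psi [_ [H [pi [xi [pi_hom pi_cc pi1 xi1 psiE]]]]] psi_e] :=
  ptws_closure_dist (cayley_sum a n) e0 (fd_dense phi_st).
have {}xi1 : rnorm xi = 1 by rewrite /rnorm xi1.
have pia := rep_a pi_hom pi_cc.
have [z xiE z_le] := bop_surj_sub xi r1 pia.
have s0 : 0 < 1 - r by rewrite subr_gt0.
have psi_ge : - (2 * r ^+ n.+1 / (1 - r)) <= complex.Re (psi (cayley_sum a n)).
  rewrite psiE {1 2}xiE Re_cayley_sum// -xiE.
  have az : rnorm (pi a z) <= rnorm z.
    apply: le_trans (opnorm_bound _ _) _; rewrite ler_piMl ?rnorm_ge0//.
    exact: le_trans pia (ltW r1).
  have : rnorm (pi a z) ^+ 2 <= rnorm z ^+ 2.
    by rewrite ler_sqr ?nnegrE ?rnorm_ge0.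
  have : complex.Re (inner (pi (a ^+ n.+1) z) xi) <= r ^+ n.+1 / (1 - r).
    apply: le_trans (Re_inner_le _ _) _; rewrite xi1 mulr1.
    apply: le_trans (rep_pow n.+1 z pi_hom pi1 r0 pia) _.
    rewrite ler_wpM2l ?exprn_ge0//; rewrite xi1 mulrC in z_le.
    by rewrite -[leRHS]mul1r ler_pdivlMr.
  by rewrite -mulrA; lra.
have := Re_rnorm (psi (cayley_sum a n) - phi (cayley_sum a n)).
rewrite raddfB /= => /le_lt_trans/(_ psi_e); rewrite ltr_norml => /andP[_].
by move: psi_ge; lra.
Qed.

(** The bounds on the vector states of [K] make [`|a z|^2 - `|z|^2] at most a
    multiple of [r^n] for all [n]. *)
Lemma opnorm_le1 : opnorm a <= 1.
Proof.
apply: opnorm_le => z z1; apply: le_trans z1.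
rewrite -ler_sqr ?nnegrE ?rnorm_ge0// -subr_le0.
pose y := z - (a : bop K) z.
pose c := 2 / (1 - r) * rnorm y ^+ 2 + 6 * (rnorm z ^+ 2 + rnorm y ^+ 2).
have s0 : 0 < 1 - r by rewrite subr_gt0.
have c0 : 0 <= c.
  by rewrite addr_ge0// mulr_ge0 ?addr_ge0 ?sqr_ge0// divr_ge0// ltW.
apply: (@le0_geometric _ r c); rewrite ?r0// => n.
have val_hom : algebra_hom (@opalg_val R K A) by [].
have := Re_cayley_sum a n z val_hom (erefl _); rewrite -/y /=.
have y_ge : - (2 * r ^+ n.+1 / (1 - r)) * rnorm y ^+ 2 <=
    complex.Re (inner (opalg_val (cayley_sum a n) y) y).
  have [phi phi_st ->] := state_of_vector y.
  have [->|y0] := eqVneq y 0; first by rewrite rnorm0 expr0n !mulr0 mul0r.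
  by rewrite Re_scale mulrC ler_wpM2l ?sqr_ge0//; exact: state_cayley (phi_st y0).
have pow_le x :
    rnorm (inner ((a ^+ n.+1 : bop K) x) x) <= r ^+ n.+1 * rnorm x ^+ 2.
  have [phi phi_st ->] := state_of_vector x.
  have [->|x0] := eqVneq x 0; first by rewrite rnorm0 expr0n mul0r rnorm0 mulr0.
  rewrite rnormM rnorm_real ger0_norm ?sqr_ge0// mulrC ler_wpM2r ?sqr_ge0//.
  exact: state_pow (phi_st x0).
have rn0 : 0 <= r ^+ n.+1 by rewrite exprn_ge0.
have := numerical_radius_bound rn0 pow_le z y.
move/(le_trans (Re_rnorm _)); rewrite ler_norml => /andP[inner_ge _].
have rn_le : r ^+ n.+1 <= r ^+ n by rewrite exprS ler_piMl ?exprn_ge0// ltW.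
have {rn_le} : c * r ^+ n.+1 <= c * r ^+ n by rewrite ler_wpM2l.
move: y_ge inner_ge; rewrite /c -[a z]/((a : bop K) z).
set I := complex.Re (inner (opalg_val (a ^+ n.+1) z) y).
set B := complex.Re _; set q := (1 - r)^-1; set p := r ^+ n.+1.
move=> *; nra.
Qed.

End Contraction.

Lemma rep_norm_dense (R : realType) (K : hilbertType R)
    (A : unitalOperatorAlgebra K) (a : A) :
  @state_space R K A `<=` closure (@finite_dimensional_state R K A) ->
  opnorm a =
  sup [set r : R | exists (H : finHilbertType R) (pi : A -> bop H),
    [/\ algebra_hom pi, completely_contractive pi & r = opnorm (pi a)]].
Proof.
move=> fd_dense; set S := [set r : R | _].
have S_ub : ubound S (opnorm a).
  by move=> _ [H [pi [_ pi_cc ->]]]; exact: cc_contractive.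
have S0 : 0 <= sup S.
  have [->|/set0P[r Sr]] := eqVneq S set0; first by rewrite sup0.
  apply: le_trans (ub_le_sup _ Sr); last by exists (opnorm a).
  by case: Sr => H [pi [_ _ ->]]; exact: opnorm_ge0.
have S_le (H : finHilbertType R) (pi : A -> bop H) :
    algebra_hom pi -> completely_contractive pi -> opnorm (pi a) <= sup S.
  move=> pi_hom pi_cc; apply: ub_le_sup; first by exists (opnorm a).
  by exists H, pi.
apply/eqP; rewrite eq_le; apply/andP; split; last first.
  have [->|/set0P Sn0] := eqVneq S set0; first by rewrite sup0 opnorm_ge0.
  exact: ge_sup.
rewrite leNgt; apply/negP => lt_a.
(* rescaling by a number strictly between the supremum and the norm of a *)
pose c := (sup S + opnorm a) / 2.
have Sc : sup S < c by rewrite /c midf_lt.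
have ca : c < opnorm a by rewrite /c midf_lt.
have c0 : 0 < c := le_lt_trans S0 Sc.
have normc b : opnorm (c^-1%:C *: b : bop K) = c^-1 * opnorm b.
  by rewrite opnormZ rnorm_real ger0_norm// invr_ge0 ltW.
have : opnorm (c^-1%:C *: a : A) <= 1.
  apply: (@opnorm_le1 _ _ _ fd_dense _ (c^-1 * sup S)).
  - by rewrite mulr_ge0// invr_ge0 ltW.
  - by rewrite mulrC ltr_pdivrMr// mul1r.
  move=> H pi pi_hom pi_cc; have [pi_lin _] := pi_hom.
  have pi0 : pi 0 = 0 by have := pi_lin (-1) 0 0; rewrite !scaleN1r !addNr.
  have := pi_lin (c^-1%:C) a 0; rewrite !addr0 pi0 addr0 => ->.
  rewrite opnormZ rnorm_real ger0_norm ?invr_ge0 ?(ltW c0)//.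
  by rewrite ler_wpM2l ?invr_ge0 ?(ltW c0)// S_le.
by rewrite normc ler_pdivrMl// mulr1 leNgt ca.
Qed.

Theorem proposition3p1 (R : realType) (K : hilbertType R)
    (A : unitalOperatorAlgebra K) :
  @state_space R K A `<=` closure (@finite_dimensional_state R K A) <->
  (forall a : A,
     opnorm a =
     sup [set r : R | exists (H : finHilbertType R) (pi : A -> bop H),
            [/\ algebra_hom pi, completely_contractive pi & r = opnorm (pi a)]]).
Proof.
split=> [fd_dense a|rep_norm phi phi_state]; first exact: rep_norm_dense.
apply: num_range_dense => // a d d0.
exact: num_range_approx.
Qed.
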